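(* Let $\{(X_t,c_t):t\in T\}$ be a family of fuzzy closure spaces. If each $(X_t,c_t)$ is ČF$T_0$, then the product fuzzy closure space $\big(\prod_{t\in T}X_t,\otimes c_t\big)$ is ČF$T_0$.
   Context: $I=[0,1]$; a fuzzy (sub)set of a non-empty set $X$ is a map $f:X\to I$, and $I^X$ is the set of all of them, ordered pointwise, with $\vee,\wedge$ pointwise supremum/infimum. $\underline 0$ is the constant $0$ fuzzy set; the complement is $\mathfrak{Co}(f)(x)=1-f(x)$. For $x\in X$ and $0<\lambda\le1$, the fuzzy point $x_\lambda$ has value $\lambda$ at $x$ and $0$ elsewhere; $x_\lambda\in f$ means $x_\lambda\le f$, i.e. $\lambda\le f(x)$. Fuzzy points $x_\lambda,y_\gamma$ are distinct if $x\ne y$. A fuzzy closure space is a pair $(X,c)$ with $X$ a non-empty set and $c:I^X\to I^X$ satisfying $c(\underline 0)=\underline 0$, $f\le c(f)$, and $c(f\vee g)=c(f)\vee c(g)$ for all $f,g\in I^X$ (idempotency is not required). For $\theta:X\to Y$ and $f\in I^X$, $\theta(f)(y)=\sup\{f(x):\theta(x)=y\}$ if $\theta^{-1}(y)\ne\emptyset$, and $0$ otherwise. Product: let $X=\prod_{t\in T}X_t$ with projections $P_t:X\to X_t$. The operator $\otimes c_t:I^X\to I^X$ is defined by: for a fuzzy point $x_\lambda$ and $f\in I^X$, $x_\lambda\le\otimes c_t(f)$ iff for every finite decomposition $f=f_1\vee\cdots\vee f_n$ with $f_i\in I^X$ there is an $i$ such that $P_t(x_\lambda)\le c_t(P_t(f_i))$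 for all $t\in T$. $(X,c)$ is ČF$T_0$ if for every two distinct fuzzy points $x_\lambda,y_\gamma$ of $X$, either $x_\lambda\in\mathfrak{Co}(c(y_\gamma))$ or $y_\gamma\in\mathfrak{Co}(c(x_\lambda))$. *)

(* Defs.v *)
From HB Require Import structures.
From mathcomp Require Import all_boot all_order all_algebra.
From mathcomp Require Import interval_inference all_classical all_reals.

Set Implicit Arguments.
Unset Strict Implicit.
Unset Printing Implicit Defensive.

Import Order.TTheory GRing.Theory Num.Theory.

Local Open Scope classical_set_scope.
Local Open Scope ring_scope.

Section FuzzySets.
Variable R : realType.

Definition i01_0 : {i01 R} := 0%:i01.

Lemma sup01_subproof (A : set {i01 R}) :
  0 <= sup [set a%:num | a in A] <= 1.
Proof.
have [->|/set0P[a Aa]] := eqVneq A set0; first by rewrite image_set0 sup0 lexx ler01.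
have ubA : ubound [set a%:num | a in A] 1 by move=> _ [b _ <-].
apply/andP; split; last by apply: ge_sup => //; exists a%:num, a.
apply: (@le_trans _ _ a%:num) => //.
by apply: ub_le_sup; [exists 1|exists a].
Qed.

(* Supremum in the complete lattice [0, 1]; sup01 set0 is 0 because the library
   sets sup set0 = 0. *)
Definition sup01 (A : set {i01 R}) : {i01 R} :=
  Itv01 (proj1 (andP (sup01_subproof A))) (proj2 (andP (sup01_subproof A))).

(* Order, join and meet on fuzzy X are the pointwise ones of boolp. *)
Definition fuzzy (X : Type) : Type := X -> {i01 R}.

Definition fuzzy0 (X : Type) : fuzzy X := fun=> i01_0.
Arguments fuzzy0 : clear implicits.

Definition fuzzyC (X : Type) (f : fuzzy X) : fuzzy X :=
  fun x => (1 - (f x)%:num)%:i01.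

(* The fuzzy point x_lam; the condition 0 < lam is stated where it is used. *)
Definition fpoint (X : Type) (x : X) (lam : {i01 R}) : fuzzy X :=
  fun y => if `[< y = x >] then lam else i01_0.

Definition fpoint_in (X : Type) (x : X) (lam : {i01 R}) (f : fuzzy X) : Prop :=
  (fpoint x lam <= f)%O.

(* 0 outside the range of theta, by the convention on sup01 set0. *)
Definition fimage (X Y : Type) (theta : X -> Y) (f : fuzzy X) : fuzzy Y :=
  fun y => sup01 [set f x | x in theta @^-1` [set y]].

Record fuzzyClosureSpace := FuzzyClosureSpace {
  fcarrier :> Type ;
  fcl : fuzzy fcarrier -> fuzzy fcarrier ;
  fcarrier_inhabited : inhabited fcarrier ;
  fcl0 : fcl (fuzzy0 fcarrier) = fuzzy0 fcarrier ;
  le_fcl : forall f : fuzzy fcarrier, (f <= fcl f)%O ;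
  fclU : forall f g : fuzzy fcarrier, fcl (f `|` g)%O = (fcl f `|` fcl g)%O
}.
Arguments fcl {X} f _ : rename.

Definition CFT0 (X : fuzzyClosureSpace) : Prop :=
  forall (x y : X) (lam gam : {i01 R}),
    0 < lam%:num -> 0 < gam%:num -> x <> y ->
    fpoint_in x lam (fuzzyC (fcl (fpoint y gam))) \/
    fpoint_in y gam (fuzzyC (fcl (fpoint x lam))).

Lemma sup01_ub (A : set {i01 R}) (a : {i01 R}) : A a -> (a <= sup01 A)%O.
Proof.
move=> Aa; rewrite -num_le /=; apply: ub_le_sup; last by exists a.
by exists 1 => _ [b _ <-].
Qed.

Lemma sup01_le (A : set {i01 R}) (b : {i01 R}) :
  (forall a, A a -> (a <= b)%O) -> (sup01 A <= b)%O.
Proof.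
move=> Ab; rewrite -num_le /=.
have [->|/set0P[a Aa]] := eqVneq A set0; first by rewrite image_set0 sup0.
by apply: ge_sup => [|_ [c Ac <-]]; [exists a%:num, a|rewrite num_le Ab].
Qed.

Lemma i01_ge0 (a : {i01 R}) : (i01_0 <= a)%O.
Proof. by rewrite -num_le /=. Qed.

Lemma fpoint_inE (X : Type) (x : X) lam (f : fuzzy X) :
  fpoint_in x lam f <-> (lam <= f x)%O.
Proof.
split=> [/lefP/(_ x)|lamf]; first by rewrite /fpoint asboolT.
apply/lefP => y; rewrite /fpoint; case: asboolP => [->//|_].
exact: i01_ge0.
Qed.

Lemma fimage_le (X Y : Type) (theta : X -> Y) (f g : fuzzy X) :
  (f <= g)%O -> (fimage theta f <= fimage theta g)%O.
Proof.
move=> /lefP fg; apply/lefP => y; apply: sup01_le => _ [x xy <-].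
by apply: le_trans (fg x) _; apply: sup01_ub; exists x.
Qed.

Lemma fimage0 (X Y : Type) (theta : X -> Y) :
  fimage theta (fuzzy0 X) = fuzzy0 Y.
Proof.
apply/funext => y; apply/le_anti; rewrite i01_ge0 andbT.
by apply: sup01_le => _ [x _ <-].
Qed.

Lemma fimage_fpoint (X Y : Type) (theta : X -> Y) (x : X) lam :
  fimage theta (fpoint x lam) = fpoint (theta x) lam.
Proof.
apply/funext => y; apply/le_anti/andP; split.
  apply: sup01_le => _ [z <- <-]; rewrite /fpoint.
  case: asboolP => [->|_]; last exact: i01_ge0.
  by rewrite asboolT.
rewrite {1}/fpoint; case: asboolP => [->|_]; last exact: i01_ge0.
by apply: sup01_ub; exists x => //; rewrite /fpoint asboolT.
Qed.

Lemma fcl_le (X : fuzzyClosureSpace) (f g : fuzzy X) :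
  (f <= g)%O -> (fcl f <= fcl g)%O.
Proof. by move=> fg; rewrite -(join_r fg) fclU leUl. Qed.

Section Product.
Variables (T : Type) (X : T -> fuzzyClosureSpace).

Let prodX : Type := forall t, X t.
Let P (t : T) : prodX -> X t := fun x => x t.

(* The decompositions f = g_1 \/ ... \/ g_n include n = 0, whose join is
   fuzzy0. When T is inhabited this changes nothing (prod_nearP); when T is
   empty it gives the one-point product a closure operator fixing fuzzy0. *)
Definition prod_near (x : prodX) (lam : {i01 R}) (f : fuzzy prodX) : Prop :=
  forall (n : nat) (g : 'I_n -> fuzzy prodX),
    f = \big[Order.join/fuzzy0 prodX]_(i < n) g i ->
    exists i : 'I_n, forall t : T,
      (fimage (@P t) (fpoint x lam) <= fcl (fimage (@P t) (g i)))%O.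

(* Determined by prod_near: see fpoint_in_prod_fcl. *)
Definition prod_fcl (f : fuzzy prodX) : fuzzy prodX :=
  fun x => sup01 [set lam | 0 < lam%:num /\ prod_near x lam f].

Lemma prod_nearE x lam f : prod_near x lam f <->
  forall (n : nat) (g : 'I_n -> fuzzy prodX),
    f = \big[Order.join/fuzzy0 prodX]_(i < n) g i ->
    exists i : 'I_n, forall t : T, (lam <= fcl (fimage (@P t) (g i)) (x t))%O.
Proof.
by split=> xf n g /xf[i gi]; exists i => t;
  have := gi t; rewrite fimage_fpoint => /fpoint_inE.
Qed.

Lemma prod_nearP (x : prodX) (lam : {i01 R}) (f : fuzzy prodX) :
  inhabited T -> 0 < lam%:num ->
  prod_near x lam f <->
  forall (n : nat) (g : 'I_n.+1 -> fuzzy prodX),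
    f = \big[Order.join/fuzzy0 prodX]_(i < n.+1) g i ->
    exists i : 'I_n.+1, forall t : T,
      (fimage (@P t) (fpoint x lam) <= fcl (fimage (@P t) (g i)))%O.
Proof.
move=> [t0] lam0; split=> [xf n g /xf//|xf [|n] g fE]; last exact: xf.
have [|_ /(_ t0)] := xf 0%N (fun=> fuzzy0 prodX).
  by rewrite fE !big_ord_recl !big_ord0 joinxx.
by rewrite fimage_fpoint fimage0 fcl0 => /fpoint_inE; rewrite -num_le leNgt lam0.
Qed.

Lemma fpoint_in_prod_fcl (x : prodX) (lam : {i01 R}) (f : fuzzy prodX) :
  0 < lam%:num -> fpoint_in x lam (prod_fcl f) <-> prod_near x lam f.
Proof.
move=> lam0; rewrite fpoint_inE; split=> [lamf|xf]; last exact: sup01_ub.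
apply/prod_nearE => n g fE; apply: contrapT => /forallNP nog.
have bad i : exists t, (fcl (fimage (@P t) (g i)) (x t) < lam)%O.
  have /existsNP[t /negP gt] := nog i.
  by exists t; rewrite ltNge.
have {}bad i : exists b : {i01 R}, (b < lam)%O /\
    exists t, (fcl (fimage (@P t) (g i)) (x t) <= b)%O.
  by have [t gt] := bad i; exists (fcl (fimage (@P t) (g i)) (x t)); split;
    [|exists t].
have [b bP] := choice bad.
pose m : {i01 R} := \big[Order.max/i01_0]_(i < n) b i.
have mlam : (m < lam)%O.
  by rewrite /m; elim/big_ind: _ => [|u v ul vl|i _];
    [rewrite -num_lt|rewrite gt_max ul|case: (bP i)].
suff : (prod_fcl f x <= m)%O by move=> /(le_trans lamf); rewrite leNgt mlam.
apply: sup01_le => mu [_ /prod_nearE/(_ n g fE)[i gi]].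
have [_ [t /(le_trans (gi t))]] := bP i.
by move=> /le_trans; apply; rewrite /m; apply: le_bigmax.
Qed.

Lemma joins_fuzzyE (Y : Type) n (g : 'I_n -> fuzzy Y) y :
  (\big[Order.join/fuzzy0 Y]_(i < n) g i : fuzzy Y) y =
  \big[Order.max/i01_0]_(i < n) g i y.
Proof.
elim: n g => [|n IHn] g; first by rewrite !big_ord0.
by rewrite !big_ord_recl joinfE IHn joinEtotal.
Qed.

Lemma prod_inhabited : inhabited prodX.
Proof. by constructor=> t; apply: inhabited_witness (fcarrier_inhabited _). Qed.

Lemma le_prod_fcl (f : fuzzy prodX) : (f <= prod_fcl f)%O.
Proof.
apply/lefP => x; have [fx0|fx0] := leP (f x)%:num 0.
  by apply: le_trans (i01_ge0 _); rewrite -num_le.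
apply/fpoint_inE/(fpoint_in_prod_fcl _ _ fx0)/prod_nearE => n g fE.
have [i fgi] : exists i, (f x <= g i x)%O.
  apply: contrapT => /forallNP gf.
  suff : (f x < f x)%O by rewrite ltxx.
  rewrite {1}fE joins_fuzzyE; elim/big_ind: _ => [|u v uf vf|i _].
  - by rewrite -num_lt.
  - by rewrite gt_max uf.
  - by rewrite ltNge; apply/negP/gf.
exists i => t; apply: le_trans fgi _.
apply: le_trans (lefP _ _ (le_fcl (fimage (@P t) (g i))) (x t)).
by apply: sup01_ub; exists x.
Qed.

Lemma prod_fcl0 : prod_fcl (fuzzy0 prodX) = fuzzy0 prodX.
Proof.
apply/funext => x; apply/le_anti; rewrite i01_ge0 andbT.
apply: sup01_le => lam [_ xlam].
have [|[]//] := xlam 0%N (fun=> fuzzy0 prodX).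
by rewrite big_ord0.
Qed.

Lemma prod_near_le x lam (f g : fuzzy prodX) :
  (f <= g)%O -> prod_near x lam f -> prod_near x lam g.
Proof.
move=> fg /prod_nearE xf; apply/prod_nearE => n h gE.
have [|i hi] := xf n (fun i => f `&` h i)%O.
  rewrite -{1}(meet_l fg) gE; elim: (n) h {gE} => [|k IHk] h.
    rewrite !big_ord0; apply/funext => y; apply/le_anti.
    by rewrite leIr i01_ge0.
  rewrite !big_ord_recl -IHk; apply/funext => y.
  by rewrite !(meetfE, joinfE) meetUr.
exists i => t; apply: le_trans (hi t) _.
by apply: (lefP _ _ _ (x t)); apply: fcl_le; apply: fimage_le; rewrite leIr.
Qed.

Lemma prod_fcl_le (f g : fuzzy prodX) :
  (f <= g)%O -> (prod_fcl f <= prod_fcl g)%O.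
Proof.
move=> fg; apply/lefP => x; apply: sup01_le => lam [lam0 xf].
by apply: sup01_ub; split=> //; apply: prod_near_le xf.
Qed.

Lemma prod_nearU x lam (f g : fuzzy prodX) : prod_near x lam (f `|` g)%O ->
  prod_near x lam f \/ prod_near x lam g.
Proof.
move=> xfg; apply: contrapT => /not_orP[].
move=> /existsNP[n /existsNP[h /not_implyP[fE nf]]].
move=> /existsNP[m /existsNP[k /not_implyP[gE ng]]].
pose hk (i : 'I_(n + m)) :=
  match fintype.split i with inl j => h j | inr j => k j end.
have [|i] := xfg _ hk.
  apply/funext => y; rewrite joinfE fE gE !joins_fuzzyE joinEtotal.
  apply/le_anti/andP; split.
    rewrite ge_max; apply/andP; split; apply/bigmax_leP;
      (split=> [|i _]; first exact: i01_ge0).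
      have -> : h i = hk (lshift m i) by rewrite /hk (unsplitK (inl _)).
      exact: (le_bigmax _ (fun j => hk j y)).
    have -> : k i = hk (rshift n i) by rewrite /hk (unsplitK (inr _)).
    exact: (le_bigmax _ (fun j => hk j y)).
  apply/bigmax_leP; split=> [|i _]; first exact: i01_ge0.
  rewrite /hk; case: (fintype.split i) => j; rewrite le_max; apply/orP.
    by left; exact: (le_bigmax _ (fun j => h j y)).
  by right; exact: (le_bigmax _ (fun j => k j y)).
by rewrite /hk; case: (fintype.split i) => j hj; [apply: nf|apply: ng]; exists j.
Qed.

Lemma prod_fclU (f g : fuzzy prodX) :
  prod_fcl (f `|` g)%O = (prod_fcl f `|` prod_fcl g)%O.
Proof.
apply/le_anti/andP; split; last first.
  by rewrite leUx !prod_fcl_le ?leUl ?leUr.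
apply/lefP => x; rewrite joinfE joinEtotal; apply: sup01_le => lam [lam0].
by move=> /prod_nearU[]xf; rewrite le_max; apply/orP; [left|right];
  apply: sup01_ub.
Qed.

Definition prod_fuzzyClosureSpace : fuzzyClosureSpace :=
  FuzzyClosureSpace prod_inhabited prod_fcl0 le_prod_fcl prod_fclU.

End Product.
End FuzzySets.

(* Main.v *)
(** The trivial decomposition of [f] shows that each projection maps the product
    closure of [f] below the closure of the image of [f]. Two distinct points of
    the product differ in some coordinate [t], and the complement being antitone,
    a T0 separation in [X t] lifts to the product. *)
Require Import Defs.
From mathcomp Require Import all_boot all_order all_algebra.
From mathcomp Require Import interval_inference all_classical all_reals.

Import Order.TTheory GRing.Theory Num.Theory.

Lemma prod_fcl_le_proj (R : realType) (T : Type) (X : T -> fuzzyClosureSpace R)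
    (f : fuzzy R (forall t, X t)) (x : forall t, X t) (t : T) :
  (prod_fcl f x <= fcl (fimage (fun z : forall t, X t => z t) f) (x t))%O.
Proof.
apply: sup01_le => mu [_ /prod_nearE xf].
(* With one term there is a single index, and its bound at coordinate [t] is the claim. *)
have [|_ /(_ t)//] := xf 1%N (fun=> f).
by apply/funext => z; rewrite joins_fuzzyE big_ord_recl big_ord0 max_l ?i01_ge0.
Qed.

(** Two carriers are allowed because a closure on the product is compared with one on a factor. *)
Lemma fuzzyC_le (R : realType) (Y Z : Type) (f : fuzzy R Y) (g : fuzzy R Z) y z :
  (f y <= g z)%O -> (fuzzyC g z <= fuzzyC f y)%O.
Proof. by rewrite -!num_le /= => fg; apply: lerB. Qed.

Lemma fpoint_in_prod_fuzzyC (R : realType) (T : Type)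
    (X : T -> fuzzyClosureSpace R) (x y : forall t, X t) (lam gam : {i01 R})
    (t : T) :
  fpoint_in (x t) lam (fuzzyC (fcl (fpoint (y t) gam))) ->
  fpoint_in x lam (fuzzyC (prod_fcl (fpoint y gam))).
Proof.
move=> /fpoint_inE xy; apply/fpoint_inE; apply: le_trans xy _.
(* [fpoint (y t) gam] is the projection of [fpoint y gam], of the same height. *)
apply: fuzzyC_le; rewrite -(fimage_fpoint (fun z : forall t, X t => z t)).
exact: prod_fcl_le_proj.
Qed.

Theorem theorem4p5 (R : realType) (T : Type) (X : T -> fuzzyClosureSpace R) :
  (forall t : T, CFT0 (X t)) -> CFT0 (prod_fuzzyClosureSpace X).
Proof.
move=> XT0 x y lam gam lam0 gam0 xy.
have [t xyt] : exists t, x t <> y t.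
  apply: contrapT => /forallNP eqxy; apply: xy.
  by apply: functional_extensionality_dep => t; apply: contrapT; apply: eqxy.
(* The factor is separated at the same heights [lam] and [gam]. *)
have [sep|sep] := XT0 t _ _ _ _ lam0 gam0 xyt.
  by left; apply: fpoint_in_prod_fuzzyC sep.
by right; apply: fpoint_in_prod_fuzzyC sep.
Qed.
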